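(* The Dietz axioms do not imply the Algebra Axiom; i.e., there exist a Noetherian local domain $(R,m)$ and a Dietz closure on $R$ that does not satisfy the Algebra Axiom.
   Context: All rings are commutative, Noetherian, with unity. Closure operation: a closure operation $\mathrm{cl}$ on a ring $R$ is a map $N \mapsto N_M^{\mathrm{cl}}$ assigning to each submodule $N$ of a finitely generated $R$-module $M$ a submodule $N_M^{\mathrm{cl}}$ of $M$ such that for $N \subseteq N' \subseteq M$ finitely generated: $N \subseteq N_M^{\mathrm{cl}}$; $(N_M^{\mathrm{cl}})_M^{\mathrm{cl}} = N_M^{\mathrm{cl}}$; $N_M^{\mathrm{cl}} \subseteq (N')_M^{\mathrm{cl}}$. Dietz closure: a closure operation $\mathrm{cl}$ on a local domain $(R,m)$ is a Dietz closure if for all finitely generated $R$-modules $N \subseteq M$ and $W$ the following Dietz axioms hold: (1) (Functoriality) for every homomorphism $f: M \to W$, $f(N_M^{\mathrm{cl}}) \subseteq f(N)_W^{\mathrm{cl}}$; (2) (Semi-residuality) if $N_M^{\mathrm{cl}} = N$ then $0_{M/N}^{\mathrm{cl}} = 0$; (3) (Faithfulness) $m_R^{\mathrm{cl}} = m$; (4) (Generalized Colon-Capturing) if $x_1,\dots,x_{k+1}$ is a partial system of parameters for $R$, $J = (x_1,\dots,x_k)$, $f: M \to R/J$ is a surjective homomorphism and $v \in M$ satisfies $f(v) = x_{k+1} + J$, then $(Rv)_M^{\mathrm{cl}} \cap \ker f \subseteq (Jv)_M^{\mathrm{cl}}$. Phantom extension: let $M$ be a finitely generated $R$-module and $\alpha: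 R \to M$ an injective $R$-linear map with cokernel $Q$. Let $\epsilon \in \mathrm{Ext}^1_R(Q,R)$ correspond to $0 \to R \to M \to Q \to 0$. Then $\alpha$ is $\mathrm{cl}$-phantom if $\epsilon \in 0^{\mathrm{cl}}_{\mathrm{Ext}^1_R(Q,R)}$. Equivalently, if $P_\bullet$ is a projective resolution of $Q$ by finitely generated projectives and $\phi \in \mathrm{Hom}_R(P_1,R)$ is a cocycle representing $\epsilon$, then $\phi$ lies in the $\mathrm{cl}$-closure, in $\mathrm{Hom}_R(P_1,R)$, of the image of $\mathrm{Hom}_R(P_0,R) \to \mathrm{Hom}_R(P_1,R)$. Algebra Axiom: for every finitely generated $R$-module $M$, if $\alpha: R \to M$, $1 \mapsto e_1$, is $\mathrm{cl}$-phantom, then $\alpha': R \to \mathrm{Sym}^2(M)$, $1 \mapsto e_1 \otimes e_1$, is $\mathrm{cl}$-phantom. *)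

(* Defs.v *)
From HB Require Import structures.
From mathcomp Require Import all_boot all_order all_algebra.
From mathcomp Require Import generic_quotient ring_quotient.
From mathcomp Require Import boolp classical_sets functions.
From mathcomp Require Import freeg.

Set Implicit Arguments.
Unset Strict Implicit.
Unset Printing Implicit Defensive.

Import GRing.Theory.
Local Open Scope classical_set_scope.
Local Open Scope quotient_scope.
Local Open Scope ring_scope.

(* Submodules of M are the inhabitants of [submodClosed M], and ideals of R the
   inhabitants of [submodClosed R^o].  Their membership predicates are boolean,
   which is no restriction because [asbool] turns any Prop into a boolean. *)

Definition lspan_pred (R : comNzRingType) (M : lmodType R) (S : set M) :
  {pred M} :=
  fun x => `[< forall N : submodClosed M, (forall y, S y -> y \in N) ->
                 x \in N >].

Lemma lspan_closed (R : comNzRingType) (M : lmodType R) (S : set M) :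
  GRing.subsemimod_closed (lspan_pred S).
Proof.
split; first split.
- by apply/asboolP => N _; rewrite rpred0.
- move=> x y /asboolP Sx /asboolP Sy; apply/asboolP => N SN.
  by rewrite rpredD ?Sx ?Sy.
- move=> a x /asboolP Sx; apply/asboolP => N SN.
  by rewrite rpredZ ?Sx.
Qed.

HB.instance Definition _ (R : comNzRingType) (M : lmodType R) (S : set M) :=
  GRing.isAddClosed.Build M (lspan_pred S) (lspan_closed S).1.
HB.instance Definition _ (R : comNzRingType) (M : lmodType R) (S : set M) :=
  GRing.isScaleClosed.Build R M (lspan_pred S) (lspan_closed S).2.

(* The submodule generated by S.  It is also used for sets that already are
   submodules, such as the image of a submodule under a linear map. *)
Definition lspan (R : comNzRingType) (M : lmodType R) (S : set M) :
  submodClosed M := lspan_pred S.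

Definition ideal_gen (R : comNzRingType) (s : seq R) : submodClosed R^o :=
  lspan [set x : R^o | x \in s].

Definition fin_gen (R : comNzRingType) (M : lmodType R) : Prop :=
  exists s : seq M, forall x : M, x \in lspan [set y | y \in s].

Definition surj (A B : Type) (f : A -> B) : Prop := forall y, exists x, f x = y.

(* M / N: the additive quotient group of the library, with its scaling. *)
Section QuotientModule.
Variables (R : comNzRingType) (M : lmodType R) (N : submodClosed M).

Lemma submod_zmod_closed : GRing.zmod_closed N.
Proof. exact: GRing.submod_closedB (submodClosedP N). Qed.

Definition submod_pred : {pred M} := fun x => x \in N.
HB.instance Definition _ := GRing.isZmodClosed.Build M submod_pred
  submod_zmod_closed.

Definition quotmod : Type := Quotient.quot submod_pred.

HB.instance Definition _ := GRing.Zmodule.on quotmod.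

Definition qproj_fun (x : M) : quotmod :=
  \pi_(Quotient.quot submod_pred) x.

Lemma qproj_surj (y : quotmod) : exists x, qproj_fun x = y.
Proof. by exists (repr (y : Quotient.quot submod_pred)); exact: reprK. Qed.

Lemma qproj_eq x y : (qproj_fun x = qproj_fun y) <-> (x - y \in N).
Proof.
rewrite /qproj_fun; split.
  by move/eqP; rewrite -Quotient.idealrBE.
by move=> Nxy; apply/eqP; rewrite -Quotient.idealrBE.
Qed.

Lemma qproj_add : {morph qproj_fun : x y / x + y}.
Proof. by move=> x y; rewrite /qproj_fun; exact: raddfD. Qed.

Definition qscale (a : R) (y : quotmod) : quotmod :=
  qproj_fun (a *: repr (y : Quotient.quot submod_pred)).

Lemma qscale_proj a x : qscale a (qproj_fun x) = qproj_fun (a *: x).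
Proof.
apply/qproj_eq; rewrite -scalerBr rpredZ //; apply/qproj_eq; exact: reprK.
Qed.

Lemma qscaleA a b y : qscale a (qscale b y) = qscale (a * b) y.
Proof. by have [x <-] := qproj_surj y; rewrite !qscale_proj scalerA. Qed.

Lemma qscale1 : left_id 1 qscale.
Proof. by move=> y; have [x <-] := qproj_surj y; rewrite qscale_proj scale1r. Qed.

Lemma qscaleDr : right_distributive qscale +%R.
Proof.
move=> a y z; have [x <-] := qproj_surj y; have [t <-] := qproj_surj z.
by rewrite -qproj_add !qscale_proj scalerDr qproj_add.
Qed.

Lemma qscaleDl y : {morph qscale^~ y : a b / a + b}.
Proof.
move=> a b; have [x <-] := qproj_surj y.
by rewrite !qscale_proj scalerDl qproj_add.
Qed.

HB.instance Definition _ := GRing.Zmodule_isLmodule.Build R quotmod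
  qscaleA qscale1 qscaleDr qscaleDl.

Lemma qproj_linear : linear qproj_fun.
Proof. by move=> a x y; rewrite qproj_add -qscale_proj. Qed.

HB.instance Definition _ := GRing.isLinear.Build R M quotmod _ qproj_fun
  qproj_linear.

Definition qproj : {linear M -> quotmod} := qproj_fun.

End QuotientModule.

(* Hom_R(U, V) as an R-module. *)
Section HomModule.
Variables (R : comNzRingType) (U V : lmodType R).
Implicit Types f g : {linear U -> V}.

HB.instance Definition _ := gen_eqMixin {linear U -> V}.
HB.instance Definition _ := gen_choiceMixin {linear U -> V}.

Lemma hom_eqP f g : f =1 g -> f = g.
Proof.
case: f g => [f [[f1] [f2]]] [g [[g1] [g2]]] /= /funext fg.
by case: g / fg g1 g2 => g1 g2; rewrite (Prop_irrelevance f1 g1)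
  (Prop_irrelevance f2 g2).
Qed.

Definition hom_zero : {linear U -> V} := \0.
Definition hom_opp f : {linear U -> V} := -%R \o f.
Definition hom_add f g : {linear U -> V} := f \+ g.
Definition hom_scale (a : R) f : {linear U -> V} := a \*: f.

Lemma hom_addA : associative hom_add.
Proof. by move=> f g h; apply: hom_eqP => x /=; rewrite addrA. Qed.

Lemma hom_addC : commutative hom_add.
Proof. by move=> f g; apply: hom_eqP => x /=; rewrite addrC. Qed.

Lemma hom_add0 : left_id hom_zero hom_add.
Proof. by move=> f; apply: hom_eqP => x /=; rewrite add0r. Qed.

Lemma hom_addN : left_inverse hom_zero hom_opp hom_add.
Proof. by move=> f; apply: hom_eqP => x /=; rewrite addNr. Qed.

HB.instance Definition _ := GRing.isZmodule.Build {linear U -> V}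
  hom_addA hom_addC hom_add0 hom_addN.

Lemma hom_scaleA a b f : hom_scale a (hom_scale b f) = hom_scale (a * b) f.
Proof. by apply: hom_eqP => x /=; rewrite scalerA. Qed.

Lemma hom_scale1 : left_id 1 hom_scale.
Proof. by move=> f; apply: hom_eqP => x /=; rewrite scale1r. Qed.

Lemma hom_scaleDr : right_distributive hom_scale +%R.
Proof. by move=> a f g; apply: hom_eqP => x /=; rewrite scalerDr. Qed.

Lemma hom_scaleDl f : {morph hom_scale^~ f : a b / a + b}.
Proof. by move=> a b; apply: hom_eqP => x /=; rewrite scalerDl. Qed.

HB.instance Definition _ := GRing.Zmodule_isLmodule.Build R {linear U -> V}
  hom_scaleA hom_scale1 hom_scaleDr hom_scaleDl.

End HomModule.

(* M (x) N: the free module on M * N modulo the bilinearity relations. *)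
Section Tensor.
Variables (R : comNzRingType) (M N : lmodType R).

Definition tens_rel (z : {freeg (M * N) / R}) : Prop :=
  [\/ exists x x' y, z = << (x + x', y) >> - << (x, y) >> - << (x', y) >>,
      exists x y y', z = << (x, y + y') >> - << (x, y) >> - << (x, y') >>,
      exists (a : R) x y, z = << (a *: x, y) >> - a *: << (x, y) >> |
      exists (a : R) x y, z = << (x, a *: y) >> - a *: << (x, y) >>].

Definition tensor : lmodType R := quotmod (lspan tens_rel).

Definition tens (x : M) (y : N) : tensor := qproj _ << (x, y) >>.

End Tensor.

(* Sym^2(M) = (M (x) M) / (x (x) y - y (x) x). *)
Section Sym2.
Variables (R : comNzRingType) (M : lmodType R).

Definition sym2_rel (z : tensor M M) : Prop :=
  exists x y, z = tens x y - tens y x.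

Definition sym2 : lmodType R := quotmod (lspan sym2_rel).

Definition sym2_mul (x y : M) : sym2 := qproj _ (tens x y).

End Sym2.

(* The R-linear map R -> M sending 1 to e. *)
Section FromRing.
Variables (R : comNzRingType) (M : lmodType R) (e : M).

Definition from_ring_fun (a : R^o) : M := (a : R) *: e.

Lemma from_ring_linear : linear from_ring_fun.
Proof. by move=> a x y; rewrite /from_ring_fun scalerDl scalerA. Qed.

HB.instance Definition _ := GRing.isLinear.Build R R^o M _ from_ring_fun
  from_ring_linear.

Definition from_ring : {linear R^o -> M} := from_ring_fun.

End FromRing.

Definition noetherian (R : comNzRingType) : Prop :=
  forall I : submodClosed R^o, exists s : seq R, I =i ideal_gen s.

Definition maximal_ideal (R : comNzRingType) (m : submodClosed R^o) : Prop :=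
  (1 : R^o) \notin m /\
  forall J : submodClosed R^o, (1 : R^o) \notin J -> {subset m <= J} -> J =i m.

Definition local_ring (R : comNzRingType) (m : submodClosed R^o) : Prop :=
  maximal_ideal m /\ forall J : submodClosed R^o, maximal_ideal J -> J =i m.

(* There is a strict chain p_0 < p_1 < ... < p_n of prime ideals; the terms of
   the sequence beyond p_n are irrelevant. *)
Definition prime_chain (R : comNzRingType) (n : nat) : Prop :=
  exists p : nat -> prime_idealr R, forall i, (i < n)%N ->
    {subset p i <= p i.+1} /\ exists x : R, x \in p i.+1 /\ x \notin p i.

Definition krull_dim (R : comNzRingType) (n : nat) : Prop :=
  prime_chain R n /\ ~ prime_chain R n.+1.

(* dim R elements of m generating an m-primary ideal. *)
Definition sop (R : comNzRingType) (m : submodClosed R^o) (s : seq R) : Prop :=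
  [/\ krull_dim R (size s),
      forall x : R, x \in s -> (x : R^o) \in m &
      forall a : R, (a : R^o) \in m ->
        exists n, (a ^+ n : R^o) \in ideal_gen s].

Definition partial_sop (R : comNzRingType) (m : submodClosed R^o) (s : seq R) :
  Prop := exists t : seq R, sop m (s ++ t).

(* The values on modules that are not finitely generated are irrelevant:
   every condition below only concerns finitely generated modules. *)
Definition closure_map (R : comNzRingType) : Type :=
  forall M : lmodType R, submodClosed M -> submodClosed M.

(* Over a Noetherian ring, submodules of finitely generated modules are
   finitely generated, so no such hypothesis is put on N and N'. *)
Record closure_operation (R : comNzRingType) (cl : closure_map R) : Prop := {
  cl_extensive : forall (M : lmodType R) (N : submodClosed M), fin_gen M ->
    {subset N <= cl M N};
  cl_idempotent : forall (M : lmodType R) (N : submodClosed M), fin_gen M ->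
    cl M (cl M N) =i cl M N;
  cl_monotone : forall (M : lmodType R) (N N' : submodClosed M), fin_gen M ->
    {subset N <= N'} -> {subset cl M N <= cl M N'}
}.

Record dietz_closure (R : comNzRingType) (m : submodClosed R^o)
    (cl : closure_map R) : Prop := {
  dietz_closure_operation : closure_operation cl;
  dietz_functorial : forall (M W : lmodType R) (f : {linear M -> W})
      (N : submodClosed M), fin_gen M -> fin_gen W ->
    forall v, v \in cl M N -> f v \in cl W (lspan (f @` [set x | x \in N]));
  dietz_semi_residual : forall (M : lmodType R) (N : submodClosed M),
    fin_gen M -> cl M N =i N ->
    cl (quotmod N) (lspan set0) =i (lspan set0 : submodClosed (quotmod N));
  dietz_faithful : cl R^o m =i m;
  dietz_colon_capturing : forall (xs : seq R) (x : R),
    partial_sop m (rcons xs x) ->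
    forall (M : lmodType R) (f : {linear M -> quotmod (ideal_gen xs)}) (v : M),
      fin_gen M -> surj f -> f v = qproj (ideal_gen xs) x ->
    forall u, u \in cl M (lspan [set v]) -> f u = 0 ->
      u \in cl M (lspan [set w | exists2 j : R,
                            (j : R^o) \in ideal_gen xs & w = j *: v])
}.

Definition projective (R : comNzRingType) (P : lmodType R) : Prop :=
  forall (A B : lmodType R) (g : {linear A -> B}) (f : {linear P -> B}),
    surj g -> exists h : {linear P -> A}, forall x, g (h x) = f x.

Record fg_projective_resolution (R : comNzRingType) (Q : lmodType R)
    (P : nat -> lmodType R) (d : forall n, {linear P n.+1 -> P n})
    (aug : {linear P 0%N -> Q}) : Prop := {
  res_fin_gen : forall n, fin_gen (P n);
  res_projective : forall n, projective (P n);
  res_aug_surj : surj aug;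
  res_exact0 : forall x, aug x = 0 <-> exists y, d 0%N y = x;
  res_exact : forall n x, d n x = 0 <-> exists y, d n.+1 y = x
}.

Definition cokernel (R : comNzRingType) (A B : lmodType R)
    (f : {linear A -> B}) : lmodType R :=
  quotmod (lspan (range f)).

(* phi : P_1 -> R is a cocycle representing the class in Ext^1(Q, R) of
   0 -> R -> M -> Q -> 0: it is induced by a lift f0 : P_0 -> M of P_0 -> Q.
   The other sign convention replaces phi by - phi, which is in the same
   submodules. *)
Definition represents_extension (R : comNzRingType) (M : lmodType R)
    (alpha : {linear R^o -> M})
    (P : nat -> lmodType R) (d : forall n, {linear P n.+1 -> P n})
    (aug : {linear P 0%N -> cokernel alpha}) (phi : {linear P 1%N -> R^o}) :
    Prop :=
  (forall z, phi (d 1%N z) = 0) /\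
  exists f0 : {linear P 0%N -> M},
    (forall x, qproj (lspan (range alpha)) (f0 x) = aug x) /\
    (forall y, f0 (d 0%N y) = alpha (phi y)).

(* The image of Hom(P_0, R) -> Hom(P_1, R). *)
Definition coboundaries (R : comNzRingType) (P1 P0 : lmodType R)
    (d : {linear P1 -> P0}) : submodClosed {linear P1 -> R^o} :=
  lspan (range (fun h : {linear P0 -> R^o} => h \o d : {linear P1 -> R^o})).

(* The condition that the class epsilon of the extension is in
   0^cl_{Ext^1(Q, R)}, in the form given by representing cocycles: the closure
   is taken in Hom(P_1, R), not in its submodule of cocycles. *)
Definition phantom (R : comNzRingType) (cl : closure_map R) (M : lmodType R)
    (alpha : {linear R^o -> M}) : Prop :=
  injective alpha /\
  forall (P : nat -> lmodType R) (d : forall n, {linear P n.+1 -> P n})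
    (aug : {linear P 0%N -> cokernel alpha}),
    fg_projective_resolution d aug ->
  forall phi : {linear P 1%N -> R^o}, represents_extension d aug phi ->
    phi \in cl {linear P 1%N -> R^o} (coboundaries (d 0%N)).

Definition algebra_axiom (R : comNzRingType) (cl : closure_map R) : Prop :=
  forall (M : lmodType R) (e : M), fin_gen M ->
    phantom cl (from_ring e) -> phantom cl (from_ring (sym2_mul e e)).

(* Main.v *)
Require Import Defs.
From mathcomp Require Import all_boot all_algebra.
From mathcomp Require Import boolp classical_sets.
From mathcomp Require Import freeg.
From mathcomp Require Import generic_quotient ring_quotient fraction.
From mathcomp Require Import ring.
From HB Require Import structures.

Set Implicit Arguments.
Unset Strict Implicit.
Unset Printing Implicit Defensive.

Import GRing.Theory.
Local Open Scope ring_scope.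

(** Let D be the ring of rational functions in t, over a field K, that are
    regular at 0, and let R = K + t^3 D, a Noetherian local domain of
    dimension one with maximal ideal m = t^3 D. Let I = (t^3, t^4) = t^3 (K +
    Kt + t^3 D), which is isomorphic to the canonical module of R. The
    counterexample is the module closure of I: an element u of W lies in the
    closure of N when, for all a in I, the element a (x) u of I (x) W comes
    from I (x) N.

    Module closures are functorial and semi-residual for any module
    ([module_closure_functorial], [module_closure_semi_residual]), and
    faithful as soon as the module differs from its product with m
    ([module_closure_faithful]). In dimension one a partial system of
    parameters rcons xs x has xs empty and x nonzero, so colon-capturing only
    says the following: if a (x) u = b (x) v, f(u) = 0 and f(v) = x, then xb =
    0, hence b = 0 because I is torsion-free ([module_closure_cyclic]). This
    gives the Dietz axioms ([module_closure_dietz]).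

    An injective map alpha : R -> N, with N finitely generated, is phantom for
    the module closure of I exactly when every a in I is g(alpha(1)) for some
    linear g : N -> I ([phantom_of_extension], [extension_of_phantom]). Indeed
    Hom(P_1, R) (x) I is Hom(P_1, I), so the condition on the cocycle says
    that the pushouts of the extension along the maps R -> I split. That
    phantom maps extend uses the existence of a resolution
    ([free_resolution]).

    Take N = I x I and e = (t^3, t^4). The maps (x, y) |-> ax + by show that 1
    |-> e is phantom. If 1 |-> e.e were phantom in Sym^2(N), there would be a
    linear map Sym^2(N) -> I, that is a symmetric bilinear map N x N -> I,
    with value t^3 at (e, e), which is a sum of four values of bilinear maps I
    x I -> I. But such a map is multiplication by a rational function; if c is
    its value at (t^3, t^3), then c, tc and t^2 c all lie in I, whose elements
    divided by t^3 have no term in t^2, so c is in t^6 D ([gap_colon]). All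
    values of bilinear maps I x I -> I are thus in t^6 D ([bilin_ord]), and
    t^3 is not ([ord_ge_tvar3]), a contradiction ([gap_not_algebra]). *)

(** * Spans and finite generation *)

Section Spans.
Variable R : comNzRingType.
Implicit Types M : lmodType R.

(** The sets that are submodules, as opposed to the bundled type of boolean
    submodule predicates. *)
Definition submodule M (S : set M) : Prop :=
  [/\ S 0, forall x y, S x -> S y -> S (x + y)
    & forall (a : R) x, S x -> S (a *: x)].

Lemma lspan_sub M (S : set M) x : S x -> x \in lspan S.
Proof. by move=> Sx; apply/asboolP => N; apply. Qed.

Lemma lspan_min M (S : set M) (N : submodClosed M) :
  (forall x, S x -> x \in N) -> {subset lspan S <= N}.
Proof. by move=> SN x /asboolP; apply. Qed.

Lemma lspan_ind M (S T : set M) :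
  submodule T -> (forall x, S x -> T x) -> forall x, x \in lspan S -> T x.
Proof.
move=> [T0 TD TZ] ST x /asboolP xS.
have TN : GRing.subsemimod_closed (fun y : M => `[< T y >]).
  split; first split; first exact/asboolP.
    by move=> y z /asboolP Ty /asboolP Tz; apply/asboolP/TD.
  by move=> a y /asboolP Ty; apply/asboolP/TZ.
pose T1 := GRing.isAddClosed.Build M (fun y : M => `[< T y >]) TN.1.
pose T2 := GRing.isScaleClosed.Build R M (fun y : M => `[< T y >]) TN.2.
pose N : submodClosed M := HB.pack (fun y : M => `[< T y >]) T1 T2.
have /asboolP // : x \in N.
by apply: xS => y /ST Ty; apply/asboolP.
Qed.

Lemma lspanE M (S : set M) : submodule S -> forall x, x \in lspan S <-> S x.
Proof. by move=> sS x; split; [apply: lspan_ind | apply: lspan_sub]. Qed.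

(** Bundles a function with a proof that it is linear. *)
Definition linear_map_of M M' (f : M -> M') (fl : linear f) :
    {linear M -> M'} :=
  HB.pack_for {linear M -> M'} f (GRing.isLinear.Build R M M' _ f fl).

Lemma submod_rpredB M (N : submodClosed M) x y :
  x \in N -> y \in N -> x - y \in N.
Proof. by move=> xN yN; rewrite -(scaleN1r y) rpredD // rpredZ. Qed.

Lemma submodule_preim M M' (f : {linear M -> M'}) (N : submodClosed M') :
  submodule (fun x => f x \in N).
Proof.
split=> [|x y fx fy|a x fx]; rewrite ?linear0 ?linearD ?linearZ_LR ?rpred0 //.
  exact: rpredD.
exact: rpredZ.
Qed.

Lemma submodule_ker M M' (f : {linear M -> M'}) : submodule (fun x => f x = 0).
Proof.
split=> [|x y fx fy|a x fx]; rewrite ?linear0 ?linearD ?linearZ_LR ?fx ?fy //.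
  by rewrite addr0.
by rewrite scaler0.
Qed.

Lemma submodule_range M M' (f : {linear M -> M'}) :
  submodule (fun y => exists x, f x = y).
Proof.
split=> [|_ _ [x <-] [y <-]|a _ [x <-]]; first by exists 0; rewrite linear0.
  by exists (x + y); rewrite linearD.
by exists (a *: x); rewrite linearZ_LR.
Qed.

Lemma lspan_image M M' (f : {linear M -> M'}) S T x :
  (forall x, S x -> f x \in lspan T) -> x \in lspan S -> f x \in lspan T.
Proof.
by move=> ST xS; apply: (lspan_ind (submodule_preim f (lspan T)) ST xS).
Qed.

Lemma lspan_set0 M (x : M) : x \in lspan set0 -> x = 0.
Proof.
apply: (lspan_ind (T := fun x : M => x = 0)) => //.
by split=> [|_ _ -> ->|a _ ->]; rewrite ?addr0 ?scaler0.
Qed.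

(** The submodule generated by a finite family. *)
Definition seq_span M (s : seq M) : submodClosed M := lspan [set y | y \in s].

Lemma seq_span_mem M (s : seq M) x : x \in s -> x \in seq_span s.
Proof. exact: lspan_sub. Qed.

Lemma seq_span_nil M (x : M) : x \in seq_span [::] -> x = 0.
Proof. by move=> xS; apply: lspan_set0; apply: lspan_min xS. Qed.

Lemma seq_span_cons M (x : M) s y :
  y \in seq_span (x :: s) -> exists a, y - a *: x \in seq_span s.
Proof.
apply: (lspan_ind
  (T := fun y : M => exists a, y - a *: x \in seq_span s)) => [|z /=]; last first.
  rewrite inE => /orP[/eqP ->|zs].
    by exists 1; rewrite scale1r subrr rpred0.
  by exists 0; rewrite scale0r subr0 seq_span_mem.
split=> [|y1 y2 [a1 s1] [a2 s2]|a y1 [a1 s1]].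
- by exists 0; rewrite scale0r subrr rpred0.
- by exists (a1 + a2); rewrite scalerDl opprD addrACA rpredD.
by exists (a * a1); rewrite -scalerA -scalerBr rpredZ.
Qed.

Lemma seq_span_subset M (s s' : seq M) :
  {subset s <= s'} -> {subset seq_span s <= seq_span s'}.
Proof. by move=> ss'; apply: lspan_min => x /ss'; apply: seq_span_mem. Qed.

Lemma seq_span_map M M' (f : {linear M -> M'}) s x :
  x \in seq_span s -> f x \in seq_span (map f s).
Proof. by apply: lspan_image => y ys; apply/seq_span_mem/map_f. Qed.

(** The linear combination of s with coefficients v. *)
Definition comb_fun M (s : seq M) (v : 'rV[R]_(size s)) : M :=
  \sum_(i < size s) v 0 i *: s`_i.

Lemma comb_linear M (s : seq M) : linear (@comb_fun M s).
Proof.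
move=> a u v; rewrite /comb_fun scaler_sumr -big_split /=; apply: eq_bigr => i _.
by rewrite !mxE scalerDl scalerA.
Qed.

HB.instance Definition _ M (s : seq M) :=
  GRing.isLinear.Build R 'rV[R]_(size s) M _ (@comb_fun M s) (@comb_linear M s).

Definition comb M (s : seq M) : {linear 'rV[R]_(size s) -> M} := @comb_fun M s.

Lemma comb_delta M (s : seq M) i : comb s (delta_mx 0 i) = s`_i.
Proof.
rewrite /= /comb_fun (bigD1 i) //= mxE !eqxx scale1r big1 ?addr0 // => j ji.
by rewrite mxE eqxx (negPf ji) scale0r.
Qed.

Lemma range_comb M (s : seq M) x : x \in seq_span s <-> exists v, comb s v = x.
Proof.
split=> [|[v <-]].
  move=> xs; apply: (lspan_ind (submodule_range (comb s)) _ xs) => y /= ys.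
  have lt : (index y s < size s)%N by rewrite index_mem.
  by exists (delta_mx 0 (Ordinal lt)); rewrite comb_delta nth_index.
by apply: rpred_sum => i _; apply/rpredZ/seq_span_mem/mem_nth.
Qed.

Lemma rV_fin_gen n : fin_gen 'rV[R]_n.
Proof.
exists [seq delta_mx 0 i | i : 'I_n] => v; rewrite (row_sum_delta v).
by apply: rpred_sum => i _; apply/rpredZ/lspan_sub/map_f/mem_enum.
Qed.

Lemma fin_gen_surj M M' (f : {linear M -> M'}) :
  surj f -> fin_gen M -> fin_gen M'.
Proof.
move=> fs [s sM]; exists (map f s) => y; have [x <-] := fs y.
exact: seq_span_map.
Qed.

Lemma qprojE M (N : submodClosed M) x : qproj N x = 0 <-> x \in N.
Proof. by rewrite -[0](linear0 (qproj N)) -{2}[x]subr0; apply: qproj_eq. Qed.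

Lemma fin_gen_quot M (N : submodClosed M) : fin_gen M -> fin_gen (quotmod N).
Proof. by apply: (fin_gen_surj (f := qproj N)); apply: qproj_surj. Qed.

End Spans.

Lemma fin_gen_two (R : comNzRingType) (M : lmodType R) (x y : M) :
  (forall z, exists a b, z = a *: x + b *: y) -> fin_gen M.
Proof.
move=> xyM; exists [:: x; y] => z; have [a [b ->]] := xyM z.
apply: rpredD; apply/rpredZ/seq_span_mem; first exact: mem_head.
by apply/mem_behead/mem_head.
Qed.

Lemma fin_gen_prod (R : comNzRingType) (M N : lmodType R) :
  fin_gen M -> fin_gen N -> fin_gen (M * N)%type.
Proof.
move=> [s sM] [s' sN].
have il : linear (fun x : M => (x, 0) : (M * N)%type).
  by move=> c x y; congr pair; rewrite /= scaler0 addr0.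
have jl : linear (fun y : N => (0, y) : (M * N)%type).
  by move=> c x y; congr pair; rewrite /= scaler0 addr0.
exists (map (linear_map_of il) s ++ map (linear_map_of jl) s') => -[x y].
have -> : (x, y) = linear_map_of il x + linear_map_of jl y.
  by congr pair; rewrite /= ?addr0 ?add0r.
rewrite rpredD //.
  apply: seq_span_subset (seq_span_map (linear_map_of il) (sM x)) => z.
  by rewrite mem_cat => ->.
apply: seq_span_subset (seq_span_map (linear_map_of jl) (sN y)) => z.
by rewrite mem_cat orbC => ->.
Qed.

Section SubmoduleType.
Variables (R : comNzRingType) (M : lmodType R) (N : submodClosed M).

(** A submodule as a module in its own right. *)
Record submodule_type :=
  Submod { submod_val : M; submod_valP : submod_val \in N }.

HB.instance Definition _ := [isSub for submod_val].
HB.instance Definition _ := [Choice of submodule_type by <:].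
HB.instance Definition _ := [SubChoice_isSubLmodule of submodule_type by <:].

Lemma submod_valD x y : submod_val (x + y) = submod_val x + submod_val y.
Proof. by []. Qed.
Lemma submod_valZ a x : submod_val (a *: x) = a *: submod_val x.
Proof. by []. Qed.

End SubmoduleType.

(** * Free resolutions over a Noetherian ring *)

Section Resolutions.
Variable R : comNzRingType.
Hypothesis noethR : noetherian R.
Implicit Types M : lmodType R.

(** By induction on the length of s: the coefficients of the head of s in the
    elements of N form an ideal, and lifts of generators of that ideal, with
    generators of the part of N in the span of the tail, generate N. *)
Lemma noetherian_submodule M (s : seq M) (N : submodClosed M) :
  {subset N <= seq_span s} -> exists s', N =i seq_span s'.
Proof.
elim: s N => [|x s IH] N Ns.
  exists [::] => y; apply/idP/idP => [|/seq_span_nil ->]; last exact: rpred0.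
  exact: Ns.
(* The ideal of coefficients of x in the elements of N, modulo the span of s. *)
pose I a := exists2 y, y \in N & y - a *: x \in seq_span s.
have sI : submodule (I : set R^o).
  split=> [|a b [y yN ys] [z zN zs]|a b [y yN ys]].
  - by exists 0; rewrite ?rpred0 // scale0r subrr rpred0.
  - exists (y + z); first by rewrite rpredD.
    by rewrite (scalerDl x a b) opprD addrACA rpredD.
  exists (a *: y); first by rewrite rpredZ.
  by rewrite -(scalerA a b x) -scalerBr rpredZ.
have [t tI] := noethR (lspan (I : set R^o)).
have liftI a : exists y, a \in t -> y \in N /\ y - a *: x \in seq_span s.
  case: (boolP (a \in t)) => [at_|_]; last by exists 0.
  have /(lspanE sI) [y] : (a : R^o) \in lspan (I : set R^o).
    by rewrite tI; apply: lspan_sub.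
  by exists y.
have [g gI] := boolp.choice liftI.
pose N0 := fun y => y \in N /\ y \in seq_span s.
have sN0 : submodule (N0 : set M).
  split=> [|y z [yN ys] [zN zs]|a y [yN ys]]; split; rewrite ?rpred0 ?rpredD //;
  exact: rpredZ.
have [s0 s0E] : exists s0, lspan (N0 : set M) =i seq_span s0.
  by apply: IH => y /(lspanE sN0)[].
exists (map g t ++ s0) => y; apply/idP/idP; last first.
  apply: lspan_min => z /=; rewrite mem_cat => /orP[/mapP[a at_ ->]|zs0].
    by case: (gI a at_).
  have : z \in seq_span s0 by apply: seq_span_mem.
  by rewrite -s0E => /(lspanE sN0)[].
move=> yN; have [a ya] := seq_span_cons (Ns y yN).
have : (a : R^o) \in ideal_gen t.
  by rewrite -tI; apply/(lspanE sI); exists y.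
suff H (b : R^o) : b \in ideal_gen t ->
    exists2 z, z \in seq_span (map g t) & z \in N /\ z - b *: x \in seq_span s.
  move=> /H[z zt [zN za]]; rewrite -(subrK z y) rpredD //; last first.
    by apply: seq_span_subset zt => w wt; rewrite mem_cat wt.
  have : y - z \in seq_span s0.
    rewrite -s0E; apply/(lspanE sN0); split.
      exact: submod_rpredB.
    have -> : y - z = (y - a *: x) - (z - a *: x) by rewrite opprB addrA subrK.
    exact: submod_rpredB.
  by apply: seq_span_subset => w wt; rewrite mem_cat wt orbT.
apply: (lspan_ind (T := fun b : R^o => exists2 z, z \in seq_span (map g t) &
    z \in N /\ z - (b : R) *: x \in seq_span s)) => [|c /= ct]; last first.
  by exists (g c); [apply/seq_span_mem/map_f | apply: gI].
split=> [|b1 c [y1 yt [y1N ys]] [z zt [zN zs]]|c b1 [y1 yt [y1N ys]]].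
- by exists 0; rewrite ?rpred0 // scale0r subrr !rpred0; split.
- exists (y1 + z); first by rewrite rpredD.
  split; first by rewrite rpredD.
  by rewrite (scalerDl x b1 c) opprD addrACA rpredD.
exists (c *: y1); first by rewrite rpredZ.
split; first by rewrite rpredZ.
by rewrite -(scalerA c b1 x) -scalerBr rpredZ.
Qed.

Lemma rV_projective n : projective 'rV[R]_n.
Proof.
move=> A B g f gs.
have [a aE] := boolp.choice (fun i : 'I_n => gs (f (delta_mx 0 i))).
pose h (v : 'rV[R]_n) := \sum_i v 0 i *: a i.
have hl : linear h.
  move=> c u v; rewrite /h scaler_sumr -big_split /=; apply: eq_bigr => i _.
  by rewrite !mxE scalerDl scalerA.
exists (linear_map_of hl) => v /=.
rewrite linear_sum [in RHS](row_sum_delta v) linear_sum; apply: eq_bigr => i _.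
by rewrite !linearZ_LR aE.
Qed.

(** Every submodule of a finite free module is the image of a finite free module.
    The statement is a sigma type, so that resolutions can be defined by
    recursion. *)
Lemma free_cover n (N : submodClosed 'rV[R]_n) :
  { k : nat & { d : {linear 'rV[R]_k -> 'rV[R]_n} |
     forall x, x \in N <-> exists y, d y = x } }.
Proof.
have [s sE] := cid (rV_fin_gen R n).
have [t tE] := cid (@noetherian_submodule _ s N (fun x _ => sE x)).
by exists (size t), (comb t) => x; rewrite tE; apply: range_comb.
Qed.

Lemma free_resolution Q : fin_gen Q ->
  exists (P : nat -> lmodType R) (d : forall n, {linear P n.+1 -> P n})
    (aug : {linear P 0%N -> Q}), fg_projective_resolution d aug.
Proof.
move=> [s sQ].
(* The state at step n is the rank of P_n with the submodule to be covered by
   P_(n+1), which is the kernel of the previous map. *)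
pose st0 : {k & submodClosed 'rV[R]_k} :=
  existT _ _ (lspan (fun v => comb s v = 0)).
pose next (st : {k & submodClosed 'rV[R]_k}) : {k & submodClosed 'rV[R]_k} :=
  existT (fun k => submodClosed 'rV[R]_k) _
    (lspan (fun v => projT1 (projT2 (free_cover (projT2 st))) v = 0)).
pose st := fix st n := if n is n'.+1 then next (st n') else st0.
exists (fun n => 'rV[R]_(projT1 (st n))).
exists (fun n => sval (projT2 (free_cover (projT2 (st n))))).
exists (comb s).
split=> [n|n|y|x|n x].
- exact: rV_fin_gen.
- exact: rV_projective.
- exact/range_comb.
- rewrite -(svalP (projT2 (free_cover (projT2 st0)))).
  by symmetry; apply: lspanE; apply: submodule_ker.
rewrite -(svalP (projT2 (free_cover (projT2 (st n.+1))))).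
by symmetry; apply: lspanE; apply: submodule_ker.
Qed.

End Resolutions.

(** * Bilinear maps and the closure attached to a module *)

Section ModuleClosure.
Variable R : comNzRingType.
Implicit Types M W L : lmodType R.

Lemma hom_addE M L (f g : {linear M -> L}) x : (f + g) x = f x + g x.
Proof. by []. Qed.

Lemma hom_scaleE M L a (f : {linear M -> L}) x : (a *: f) x = a *: f x.
Proof. by []. Qed.

Lemma bilinear_of_subproof M W L (f : M -> W -> L)
    (fl : forall a, linear (f a)) :
  (forall w, linear (f ^~ w)) -> linear (fun a => linear_map_of (fl a)).
Proof. by move=> fr c a b; apply: hom_eqP => w; apply: fr. Qed.

(** Bilinear maps M x W -> L are encoded as linear maps from M to Hom(W, L). *)
Definition bilinear_of M W L (f : M -> W -> L) (fl : forall a, linear (f a))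
    (fr : forall w, linear (f ^~ w)) : {linear M -> {linear W -> L}} :=
  linear_map_of (bilinear_of_subproof fl fr).

(** The elements u of W such that every a (x) u is in the image of M (x) N in
    M (x) W, that is, such that every bilinear map on M x W vanishing on M x N
    vanishes on M x {u}.  The universal property replaces the tensor product. *)
Definition killed_by M W (N : submodClosed W) (u : W) : Prop :=
  forall L (b : {linear M -> {linear W -> L}}),
    (forall a w, w \in N -> b a w = 0) -> forall a, b a u = 0.

(** The closure operation attached to the module M; the killed elements already
    form a submodule ([module_closureP]), and the span only bundles it. *)
Definition module_closure M : closure_map R :=
  fun W N => lspan (@killed_by M W N).

Lemma module_closureP M W (N : submodClosed W) u :
  u \in module_closure M N <-> killed_by M N u.
Proof.
apply: lspanE; split=> [|x y xN yN|c x xN] L b bN a; rewrite ?linear0 //.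
  by rewrite linearD /= (xN _ _ bN) (yN _ _ bN) addr0.
by rewrite linearZ_LR /= (xN _ _ bN) scaler0.
Qed.

Lemma module_closure_closure M : closure_operation (module_closure M).
Proof.
split=> [W N _ u uN|W N _ u|W N N' _ NN' u /module_closureP uN].
- by apply/module_closureP => L b bN a; apply: bN.
- apply/idP/idP => /module_closureP uN; apply/module_closureP => L b bN.
    by apply: uN => a w /module_closureP wN; apply: wN.
  by move=> a; apply: bN; apply/module_closureP.
by apply/module_closureP => L b bN; apply: uN => a w /NN'; apply: bN.
Qed.

Lemma module_closure_functorial M W W' (f : {linear W -> W'})
    (N : submodClosed W) u :
  u \in module_closure M N ->
  f u \in module_closure M (lspan (f @` [set x | x \in N])%classic).
Proof.
move=> /module_closureP uN; apply/module_closureP => L b bN a.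
pose b' a := b a \o f : {linear W -> L}.
have b'l : linear b'.
  by move=> c x y; apply: hom_eqP => w; rewrite /b' /= linearP.
apply: (uN L (linear_map_of b'l)) => {}a w wN /=.
by apply: bN; apply: lspan_sub; exists w.
Qed.

Lemma quot_lift W L (N : submodClosed W) (g : {linear W -> L}) :
  (forall w, w \in N -> g w = 0) ->
  exists h : {linear quotmod N -> L}, forall w, h (qproj N w) = g w.
Proof.
move=> gN; have [r rK] := boolp.choice (@qproj_surj _ _ N).
have hE w : g (r (qproj N w)) = g w.
  by apply/subr0_eq; rewrite -linearB gN //; apply/qproj_eq; rewrite rK.
have hl : linear (g \o r).
  move=> a x y /=; rewrite -linearP -[RHS]hE linearP.
  by congr (g (r (a *: _ + _))); rewrite -[LHS]rK.
by exists (linear_map_of hl).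
Qed.

Lemma module_closure_semi_residual M W (N : submodClosed W) :
  module_closure M N =i N ->
  module_closure M (lspan set0 : submodClosed (quotmod N)) =i
    (lspan set0 : submodClosed (quotmod N)).
Proof.
move=> clN y; apply/idP/idP => [|/lspan_set0 ->]; last exact: rpred0.
move=> /module_closureP y0; have [u uy] := qproj_surj y.
suff uN : u \in N.
  have e : @qproj_fun R W N u = 0 by apply/qprojE.
  by rewrite -uy e rpred0.
(* A bilinear map vanishing on M x N factors through M x (W / N). *)
rewrite -clN; apply/module_closureP => L b bN a.
have [h hE] := boolp.choice (fun a => quot_lift (bN a)).
have hl : linear h.
  move=> c a1 a2; apply: hom_eqP => z; have [w <-] := qproj_surj z.
  change (h (c *: a1 + a2) (qproj N w) =
    c *: h a1 (qproj N w) + h a2 (qproj N w)).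
  by rewrite !hE linearP.
rewrite -hE; have := y0 L (linear_map_of hl) _ a; rewrite -uy; apply.
by move=> {}a w /lspan_set0 ->; rewrite linear0.
Qed.

(** The test map is the multiplication M x R -> M / mM: if u were a unit in the
    closure of m, then ux, hence x, would be in mM. *)
Lemma module_closure_faithful M (m : submodClosed R^o) (x : M) :
    (forall u : R, (u : R^o) \notin m -> exists v : R, v * u = 1) ->
    x \notin lspan [set y | exists a z,
      (a : R^o) \in m /\ y = (a : R) *: z]%classic ->
  module_closure M m =i m.
Proof.
move=> unit_m xm u; apply/idP/idP => [/module_closureP um|]; last first.
  apply: (cl_extensive (module_closure_closure M)).
  by exists [:: 1] => r; rewrite -[r]mulr1; apply/rpredZ/lspan_sub/mem_head.
apply: contraNT xm => /unit_m[v vu].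
set mM := lspan _.
pose b (a : M) (r : R^o) := qproj mM ((r : R) *: a).
have bl a : linear (b a).
  by move=> c r s; rewrite /b (scalerDl a (c * r) s) -scalerA linearP.
have br r : linear (b ^~ r).
  by move=> c a1 a2; rewrite /b scalerDr scalerA mulrC -scalerA linearP.
have /qprojE ux : qproj mM ((u : R) *: x) = 0.
  apply: (um _ (bilinear_of bl br)) => a w wm.
  by apply/qprojE/lspan_sub; exists w, a.
by rewrite -[x]scale1r -vu -scalerA rpredZ.
Qed.

(** Colon-capturing for one parameter f(v), regular on M.  Since u is in the
    closure of Rv, every a (x) u equals some a' (x) v; applying f gives
    f(v) a' = f(u) a = 0, hence a' = 0. *)
Lemma module_closure_cyclic M W (v u : W) (f : {linear W -> R^o}) :
    (forall a : M, (f v : R) *: a = 0 -> a = 0) -> f u = 0 ->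
  u \in module_closure M (lspan [set v]%classic) ->
  u \in module_closure M (lspan set0).
Proof.
move=> xreg fu /module_closureP uv; apply/module_closureP => L b _ a.
(* Pairing b with (a, w) |-> f(w) a allows both to be read off from the same a'. *)
pose g (a : M) (w : W) : (L * M)%type := (b a w, (f w : R) *: a).
have gl c : linear (g c).
  move=> r w1 w2; rewrite /g !linearP; congr pair.
  by rewrite (scalerDl c (r * f w1) (f w2)) -scalerA.
have gr w : linear (g ^~ w).
  move=> r a1 a2; rewrite /g; congr pair; first by rewrite linearP.
  by rewrite scalerDr scalerA mulrC -scalerA.
pose G := bilinear_of gl gr.
(* The values at v form a submodule S of L x M; modulo S the bilinear map g
   vanishes on M x Rv. *)
pose S := (fun p : (L * M)%type => exists a, g a v = p).
have sS : submodule S := submodule_range (linear_map_of (gr v)).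
pose q a := qproj (lspan S) \o G a : {linear W -> _}.
have ql : linear q.
  move=> c x y; apply: hom_eqP => w.
  by rewrite /q [RHS]/= -linearP; congr (qproj_fun _ _); apply: gr.
have /qprojE/(lspanE sS) [a' [ba' fa']] : q a u = 0.
  apply: (uv _ (linear_map_of ql)) => {}a w.
  move=> wv; apply/qprojE/(lspanE sS); move: w wv.
  apply: (lspan_ind (T := fun w => S (g a w))) => [|w ->]; last by exists a.
  have := submodule_preim (G a) (lspan S).
  case=> s0 sD sZ.
  by split=> [|x y /(lspanE sS) xS /(lspanE sS) yS|c x /(lspanE sS) xS];
    apply/(lspanE sS); [exact: s0 | exact: sD | exact: sZ].
by rewrite -ba' (xreg a') ?linear0 // fa' fu scale0r.
Qed.

End ModuleClosure.

Section Dietz.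
Variables (R : idomainType) (m : submodClosed R^o) (M : lmodType R) (x0 : M).
Hypothesis unit_m : forall u : R, (u : R^o) \notin m -> exists v : R, v * u = 1.
Hypothesis m_neq0 : exists2 a : R, (a : R^o) \in m & a != 0.
Hypothesis dim1 : ~ prime_chain R 2.
Hypothesis x0_notin :
  x0 \notin lspan [set y | exists a z,
    (a : R^o) \in m /\ y = (a : R) *: z]%classic.
Hypothesis M_torsion_free :
  forall (a : R) (x : M), a *: x = 0 -> a = 0 \/ x = 0.

Lemma sop_size s : sop m s -> (size s <= 1)%N.
Proof.
case=> -[[p pP] _] _ _; rewrite leqNgt; apply/negP => s2; apply: dim1.
by exists p => i i2; apply: pP; apply: leq_trans s2.
Qed.

(** The last parameter is nonzero because m, being nonzero, is not nilpotent. *)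
Lemma partial_sop_rcons xs x :
  partial_sop m (rcons xs x) -> xs = [::] /\ x != 0.
Proof.
case=> t st; have := sop_size st.
case: t st => [|y t]; last by rewrite size_cat size_rcons addnS.
rewrite cats0; case: xs => [|y xs]; last by rewrite size_rcons.
move=> [_ _ mrad] _; split=> //; apply/eqP => x_eq0.
have [a am aN0] := m_neq0; have [n] := mrad a am.
rewrite x_eq0 => an; have : a ^+ n == 0.
  apply/eqP; move: an; apply: (lspan_ind (T := fun b : R^o => b = 0)) => [|b /=].
    by split=> [|_ _ -> ->|c _ ->]; rewrite ?addr0 ?scaler0.
  by rewrite inE => /eqP.
by rewrite expf_eq0 (negPf aN0) andbF.
Qed.

Lemma module_closure_dietz : dietz_closure m (module_closure M).
Proof.
split.
- exact: module_closure_closure.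
- by move=> W W' f N _ _ v; apply: module_closure_functorial.
- by move=> W N _; apply: module_closure_semi_residual.
- exact: (module_closure_faithful unit_m x0_notin).
move=> xs x /partial_sop_rcons[-> x_neq0] W f v fgW fs fv u uv fu.
(* With no previous parameter, f takes its values in R / 0 = R. *)
have [h hE] : exists h : {linear quotmod (ideal_gen ([::] : seq R)) -> R^o},
    forall w : R^o, h (qproj (ideal_gen ([::] : seq R)) w) = w.
  apply: (@quot_lift _ _ _ _ (idfun : {linear R^o -> R^o})) => w.
  exact: (@seq_span_nil _ R^o).
apply: (cl_monotone (module_closure_closure M) (N := lspan set0)) => //.
  by apply: lspan_min.
apply: (module_closure_cyclic (f := h \o f)) uv => [a|] /=.
  by rewrite fv hE => /M_torsion_free[xe|//]; rewrite xe eqxx in x_neq0.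
by rewrite fu linear0.
Qed.

End Dietz.

(** * Phantom extensions for a module closure *)

Section Phantom.
Variable R : comNzRingType.
Implicit Types M N P : lmodType R.

Lemma dual_basis P : fin_gen P -> projective P ->
  exists n (p : 'I_n -> P) (xi : 'I_n -> {linear P -> R^o}),
    forall x, x = \sum_i (xi i x : R) *: p i.
Proof.
move=> [s sP] /(_ _ _ (comb s) idfun) [|h hE].
  by move=> y; apply/range_comb.
have xil (i : 'I_(size s)) : linear (fun x => h x 0 i : R^o).
  by move=> a x y; rewrite linearP !mxE.
exists (size s), (fun i => s`_i), (fun i => linear_map_of (xil i)) => x.
by rewrite -[LHS]hE.
Qed.

(** The map a phi : P_1 -> M is the composite of P_1 -> P_0 with g o f0, where f0
    lifts P_0 -> Q to N and g extends 1 |-> a; dual bases of P_0 and P_1 turn this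
    into an expression of a (x) phi by coboundaries. *)
Lemma phantom_of_extension M N (alpha : {linear R^o -> N}) : injective alpha ->
  (forall a : M, exists g : {linear N -> M}, g (alpha 1) = a) ->
  Defs.phantom (module_closure M) alpha.
Proof.
move=> alpha_inj ext; split=> // P d aug res phi [_ [f0 [f0aug f0d]]].
apply/module_closureP => L b b0 a; have [g ga] := ext a.
have gd y : g (f0 (d 0%N y)) = (phi y : R) *: a.
  by rewrite f0d -[phi y]mulr1 (linearZ_LR alpha) linearZ_LR ga mulr1.
have [n [p [xi pE]]] :=
  dual_basis (@res_fin_gen _ _ _ _ _ res 1) (@res_projective _ _ _ _ _ res 1).
have [k [q [eta qE]]] :=
  dual_basis (@res_fin_gen _ _ _ _ _ res 0) (@res_projective _ _ _ _ _ res 0).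
have phiE (psi : {linear P 1%N -> R^o}) : psi = \sum_i (psi (p i) : R) *: xi i.
  apply: hom_eqP => y; rewrite {1}[y]pE linear_sum /=.
  transitivity (\sum_i (psi (p i) : R) * xi i y).
    by apply: eq_bigr => i _; rewrite linearZ_LR mulrC.
  by elim/big_rec2: _ => // i u v _ ->.
have -> : b a phi = \sum_i b (g (f0 (d 0%N (p i)))) (xi i).
  rewrite [phi in LHS]phiE linear_sum; apply: eq_bigr => i _.
  by rewrite gd !linearZ_LR.
have -> : \sum_i b (g (f0 (d 0%N (p i)))) (xi i) =
    \sum_i \sum_j b (g (f0 (q j))) ((eta j (d 0%N (p i)) : R) *: xi i).
  apply: eq_bigr => i _; rewrite {1}[d 0%N (p i)]qE !linear_sum.
  elim/big_rec2: _ => // j u v _ uv.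
  by rewrite hom_addE uv !linearZ_LR.
rewrite exchange_big big1 // => j _; rewrite -linear_sum; apply: b0.
apply: lspan_sub; exists (eta j) => //.
by rewrite [LHS]phiE.
Qed.

Hypothesis noethR : noetherian R.

(** Testing the closure on Hom(P_1, M) modulo the maps that factor through
    P_1 -> P_0 shows that a phi is such a map; then the pushout of the extension
    along 1 |-> a splits. *)
Lemma extension_of_phantom M N (alpha : {linear R^o -> N}) : fin_gen N ->
    Defs.phantom (module_closure M) alpha ->
  forall a : M, exists g : {linear N -> M}, g (alpha 1) = a.
Proof.
move=> fgN [alpha_inj ph] a.
have [P [d [aug res]]] :=
  free_resolution noethR (fin_gen_quot (lspan (range alpha)) fgN).
have [f0 f0aug] := @res_projective _ _ _ _ _ res 0 _ _
  (qproj (lspan (range alpha))) aug (@qproj_surj _ _ _).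
have in_range y : y \in lspan (range alpha) -> exists r, alpha r = y.
  by apply: (lspan_ind (submodule_range alpha)) => _ [r _ <-]; exists r.
have /boolp.choice [phi phiE] y : exists r, alpha r = f0 (d 0%N y).
  by apply/in_range/qprojE; rewrite f0aug; apply/(res_exact0 res); exists y.
have phil : linear phi.
  by move=> c x y; apply: alpha_inj; rewrite !(linearP, phiE).
pose Phi : {linear P 1%N -> R^o} := linear_map_of phil.
have PhiE : represents_extension d aug Phi.
  split=> [z|]; last by exists f0; split=> // y; rewrite -[RHS]phiE.
  apply: alpha_inj; rewrite /= phiE linear0.
  have -> : d 0%N (d 1%N z) = 0 by apply/(res_exact res); exists z.
  exact: linear0.
have := ph P d aug res Phi PhiE => /module_closureP cl.
(* The coboundaries with values in M. *)
pose B : submodClosed {linear P 1%N -> M} :=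
  lspan (range (fun g : {linear P 0%N -> M} =>
    g \o d 0%N : {linear P 1%N -> M})).
pose sc (c : M) (psi : {linear P 1%N -> R^o}) : {linear P 1%N -> M} :=
  from_ring c \o psi.
have scl c : linear (fun psi => qproj B (sc c psi)).
  move=> r f g; rewrite -linearP; congr (qproj_fun _ _); apply: hom_eqP => y.
  by rewrite /sc /= /from_ring_fun (scalerDl c (r * f y) (g y)) -scalerA.
have scr psi : linear (fun c => qproj B (sc c psi)).
  move=> r f g; rewrite -linearP; congr (qproj_fun _ _); apply: hom_eqP => y.
  by rewrite /sc /= /from_ring_fun scalerDr scalerA mulrC -scalerA.
have /qprojE : qproj B (sc a Phi) = 0.
  apply: (cl _ (bilinear_of scl scr)) => c psi psiB.
  apply: (lspan_ind (submodule_ker (linear_map_of (scl c))) _ psiB).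
  move=> _ [h _ <-].
  apply/qprojE/lspan_sub; exists (from_ring c \o h) => //.
  exact: hom_eqP.
have sB : submodule (fun f : {linear P 1%N -> M} =>
    exists g : {linear P 0%N -> M}, forall y, f y = g (d 0%N y)).
  split=> [|f f' [g fg] [g' fg']|c f [g fg]].
  - by exists 0 => y.
  - by exists (g + g') => y; rewrite !hom_addE fg fg'.
  by exists (c *: g) => y; rewrite !hom_scaleE fg.
move/(lspan_ind sB) => [_ [g _ <-]|g gE]; first by exists g.
have {}gE y : (phi y : R) *: a = g (d 0%N y) by rewrite -gE.
(* The extension sends f0(p) + alpha(r) to g(p) + r a. *)
have dec y : exists pr : P 0%N * R^o, y = f0 pr.1 + alpha pr.2.
  have [p pE] := res_aug_surj res (qproj (lspan (range alpha)) y).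
  have [r rE] : exists r, alpha r = y - f0 p.
    by apply/in_range/qprojE; rewrite linearB f0aug pE subrr.
  by exists (p, r); rewrite /= rE addrC subrK.
have [pr prE] := boolp.choice dec.
have wd p r p' r' : f0 p + alpha r = f0 p' + alpha r' ->
    g p + (r : R) *: a = g p' + (r' : R) *: a.
  move=> e; have e0 : f0 (p - p') = alpha (r' - r).
    rewrite !linearB; apply/eqP.
    by rewrite subr_eq addrAC -subr_eq opprK e addrC.
  have [y yE] : exists y, d 0%N y = p - p'.
    apply/(res_exact0 res); rewrite -f0aug e0; apply/qprojE/lspan_sub.
    by exists (r' - r).
  have py : phi y = r' - r by apply: alpha_inj; rewrite phiE yE.
  apply/eqP; rewrite -subr_eq0 opprD addrACA -linearB -yE -gE py.
  by rewrite -scalerBl -scalerDl addrA addrNK subrr scale0r.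
pose G y := g (pr y).1 + ((pr y).2 : R) *: a.
have Gl : linear G.
  move=> c x y.
  have -> : c *: G x + G y = g (c *: (pr x).1 + (pr y).1) +
      (c * (pr x).2 + (pr y).2) *: a.
    by rewrite linearP scalerDl -scalerA /G scalerDr addrACA.
  apply: wd; rewrite -prE (linearP alpha c (pr x).2 (pr y).2) linearP.
  by rewrite {1}[x]prE {1}[y]prE scalerDr addrACA.
exists (linear_map_of Gl); rewrite /= /G.
rewrite (@wd _ _ 0 1) ?linear0 ?add0r ?scale1r //.
Qed.

End Phantom.

(** * Symmetric squares *)

Section SymmetricSquare.
Variables (R : comNzRingType) (N : lmodType R).

Lemma sym2_mul_linear_l (y : N) : linear (fun x => sym2_mul x y).
Proof.
move=> a x x'; rewrite /sym2_mul -linearP; congr (qproj_fun _ _).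
have D (u v : N) : tens (u + v) y = tens u y + tens v y.
  rewrite /tens -linearD; apply/qproj_eq; rewrite opprD addrA.
  by apply/lspan_sub/Or41; exists u, v, y.
rewrite D; congr (_ + _); rewrite /tens -linearZ_LR; apply/qproj_eq/lspan_sub.
by apply: Or43; exists a, x, y.
Qed.

Lemma sym2_mul_linear_r (x : N) : linear (sym2_mul x).
Proof.
move=> a y y'; rewrite /sym2_mul -linearP; congr (qproj_fun _ _).
have D (u v : N) : tens x (u + v) = tens x u + tens x v.
  rewrite /tens -linearD; apply/qproj_eq; rewrite opprD addrA.
  by apply/lspan_sub/Or42; exists x, u, v.
rewrite D; congr (_ + _); rewrite /tens -linearZ_LR; apply/qproj_eq/lspan_sub.
by apply: Or44; exists a, x, y.
Qed.

Lemma sym2_ind (S : submodClosed (sym2 N)) :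
  (forall x y, sym2_mul x y \in S) -> forall z, z \in S.
Proof.
move=> Sxy z; have [t <-] := qproj_surj z; have [D <-] := qproj_surj t.
rewrite -[D]freeg_sumE.
pose f : {linear {freeg (N * N) / R} -> sym2 N} :=
  qproj (lspan (@sym2_rel R N)) \o qproj _.
change (f (\sum_(z <- dom D) << coeff z D *g z >>) \in S).
rewrite linear_sum; apply: rpred_sum => -[x y] _.
have -> : << coeff (x, y) D *g (x, y) >> =
    coeff (x, y) D *: << (x, y) >> :> {freeg (N * N) / R}.
  by apply/eqP/freeg_eqP => w; rewrite coeffZ !coeffU mul1r.
by rewrite linearZ_LR; apply: rpredZ; apply: Sxy.
Qed.

Lemma fin_gen_sym2 : fin_gen N -> fin_gen (sym2 N).
Proof.
move=> [s sN]; exists [seq sym2_mul x y | x <- s, y <- s].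
apply: sym2_ind => x y; set S := lspan _.
pose l u := linear_map_of (sym2_mul_linear_l u).
pose r u := linear_map_of (sym2_mul_linear_r u).
apply: (lspan_ind (submodule_preim (l y) S) _ (sN x)) => u us /=.
apply: (lspan_ind (submodule_preim (r u) S) _ (sN y)) => v vs /=.
by apply: lspan_sub; apply: allpairs_f.
Qed.

End SymmetricSquare.

(** * A local domain of dimension one and multiplicity three *)

Section RationalFunctions.
Variable K : fieldType.
Local Notation F := {fraction {poly K}}.
Local Notation "x %:F" := (@FracField.tofrac _ x).

Definition tvar : F := 'X%:F.

(** The embedding of K in K(t). *)
Definition cst (c : K) : F := c%:P%:F.

(** The ring D of rational functions regular at 0. *)
Definition regular (x : F) : Prop :=
  exists p q : {poly K}, q.[0] != 0 /\ x = p%:F / q%:F.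

(** The set t^n D. *)
Definition ord_ge n (x : F) : Prop := exists2 y, regular y & x = tvar ^+ n * y.

Lemma tvar_neq0 : tvar != 0. Proof. by rewrite tofrac_eq0 polyX_eq0. Qed.

Lemma cstD a b : cst (a + b) = cst a + cst b.
Proof. by rewrite /cst polyCD tofracD. Qed.
Lemma cstM a b : cst (a * b) = cst a * cst b.
Proof. by rewrite /cst polyCM tofracM. Qed.
Lemma cstN a : cst (- a) = - cst a.
Proof. by rewrite /cst polyCN tofracN. Qed.
Lemma cst0 : cst 0 = 0.
Proof. by rewrite /cst polyC0 tofrac0. Qed.
Lemma cst1 : cst 1 = 1.
Proof. by rewrite /cst tofrac1. Qed.

Lemma frac_den_neq0 (q : {poly K}) : q.[0] != 0 -> q%:F != 0.
Proof. by rewrite tofrac_eq0; apply: contraNN => /eqP ->; rewrite horner0. Qed.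

Lemma regular_poly p : regular p%:F.
Proof. by exists p, 1; rewrite hornerC oner_neq0 tofrac1 divr1. Qed.

Lemma regularD x y : regular x -> regular y -> regular (x + y).
Proof.
move=> [p [q [q0 ->]]] [r [s [s0 ->]]]; exists (p * s + r * q), (q * s).
by rewrite hornerM mulf_neq0 // tofracD !tofracM addf_div ?frac_den_neq0.
Qed.

Lemma regularM x y : regular x -> regular y -> regular (x * y).
Proof.
move=> [p [q [q0 ->]]] [r [s [s0 ->]]]; exists (p * r), (q * s).
by rewrite hornerM mulf_neq0 // !tofracM mulf_div.
Qed.

Lemma regular_cst c : regular (cst c). Proof. exact: regular_poly. Qed.
Lemma regular_tvar : regular tvar. Proof. exact: regular_poly. Qed.
Lemma regular0 : regular 0. Proof. by rewrite -cst0; apply: regular_cst. Qed.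
Lemma regular1 : regular 1. Proof. by rewrite -cst1; apply: regular_cst. Qed.

Lemma regularN x : regular x -> regular (- x).
Proof.
by move=> rx; rewrite -mulN1r -cst1 -cstN; apply: regularM (regular_cst _) rx.
Qed.

Lemma regularX n x : regular x -> regular (x ^+ n).
Proof.
move=> rx; elim: n => [|n IH]; first by rewrite expr0; apply: regular1.
by rewrite exprS; apply: regularM.
Qed.

(** The residue field of D is K. *)
Lemma regular_split x : regular x ->
  exists c y, regular y /\ x = cst c + tvar * y.
Proof.
move=> [p [q [q0 ->]]]; exists (p.[0] / q.[0]).
have : root (p - (p.[0] / q.[0])%:P * q) 0.
  by rewrite rootE !hornerE divfK // subrr.
move=> /factor_theorem[r]; rewrite subr0 => /eqP; rewrite subr_eq => /eqP e.
exists (r%:F / q%:F); split; first by exists r, q.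
rewrite [in LHS]e tofracD !tofracM mulrDl mulfK ?frac_den_neq0 //.
by rewrite addrC mulrA [tvar * _]mulrC.
Qed.

Lemma cst_tvar_eq0 c y : regular y -> cst c + tvar * y = 0 -> c = 0.
Proof.
move=> [p [q [q0 ->]]] /(congr1 ( *%R^~ q%:F)); rewrite mul0r mulrDl -mulrA.
rewrite divfK ?frac_den_neq0 // -!tofracM -tofracD -tofrac0 => /eqP.
rewrite tofrac_eq => /eqP/(congr1 (horner^~ 0)); rewrite !hornerE /=.
by move=> /eqP; rewrite mulf_eq0 (negPf q0) orbF => /eqP.
Qed.

Lemma tvar_expansion_eq0 a b c y : regular y ->
  cst a + cst b * tvar + cst c * tvar ^+ 2 + tvar ^+ 3 * y = 0 ->
  [/\ a = 0, b = 0 & c = 0].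
Proof.
move=> ry e; have t0 := tvar_neq0.
have rc d := regular_cst d.
have rt := regular_tvar.
have a0 : a = 0.
  apply: (@cst_tvar_eq0 a (cst b + cst c * tvar + tvar ^+ 2 * y)).
    exact: regularD (regularD (rc b) (regularM (rc c) rt))
      (regularM (regularX 2 rt) ry).
  by rewrite -e; ring.
subst a; rewrite cst0 in e.
have b0 : b = 0.
  apply: (@cst_tvar_eq0 b (cst c + tvar * y)).
    exact: regularD (rc c) (regularM rt ry).
  by apply: (mulfI t0); rewrite mulr0 -[RHS]e; ring.
subst b; rewrite cst0 in e.
have c0 : c = 0.
  apply: (@cst_tvar_eq0 c y) => //.
  by apply: (mulfI (expf_neq0 2 t0)); rewrite mulr0 -[RHS]e; ring.
by [].
Qed.

Lemma regular_inv c y : c != 0 -> regular y ->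
  cst c + tvar * y != 0 /\ regular (cst c + tvar * y)^-1.
Proof.
move=> c0 ry; split; first by apply: contraNneq c0 => /(cst_tvar_eq0 ry) ->.
case: ry => p [q [q0 ->]]; exists q, (c%:P * q + 'X * p); split.
  by rewrite !hornerE /= mulf_neq0.
rewrite tofracD !tofracM -[q%:F / _]invf_div; congr (_^-1).
by rewrite mulrDl mulfK ?frac_den_neq0 // mulrA.
Qed.

Lemma regular_factor x : regular x -> x != 0 ->
  exists n u, [/\ regular u, regular u^-1, u != 0 & x = tvar ^+ n * u].
Proof.
move=> [p [q [q0 ->]]] x0.
have p0 : p != 0 by apply: contraNneq x0 => ->; rewrite tofrac0 mul0r.
have [n [r r0 pE]] := multiplicity_XsubC p 0.
rewrite p0 /= rootE in r0; exists n, (r%:F / q%:F); split.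
- by exists r, q.
- by rewrite invf_div; exists q, r.
- by rewrite mulf_neq0 ?invr_eq0 ?frac_den_neq0.
by rewrite pE subr0 tofracM tofracXn mulrAC mulrC.
Qed.

Lemma ord_ge0 x : ord_ge 0 x <-> regular x.
Proof.
split=> [[y ry ->]|rx]; first by rewrite mul1r.
by exists x => //; rewrite mul1r.
Qed.

Lemma ord_geD n x y : ord_ge n x -> ord_ge n y -> ord_ge n (x + y).
Proof.
move=> [a ra ->] [b rb ->].
by exists (a + b); [apply: regularD | rewrite mulrDr].
Qed.

Lemma ord_geM n k x y : ord_ge n x -> ord_ge k y -> ord_ge (n + k) (x * y).
Proof.
move=> [a ra ->] [b rb ->]; exists (a * b); first exact: regularM.
by rewrite exprD mulrACA.
Qed.

Lemma ord_geMl n x y : regular x -> ord_ge n y -> ord_ge n (x * y).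
Proof.
move=> rx [b rb ->]; exists (x * b); first exact: regularM.
by rewrite mulrCA.
Qed.

Lemma ord_geMr n x y : regular y -> ord_ge n x -> ord_ge n (x * y).
Proof. by move=> ry xn; rewrite mulrC; apply: ord_geMl. Qed.

Lemma ord_geN n x : ord_ge n x -> ord_ge n (- x).
Proof.
by move=> [a ra ->]; exists (- a); [apply: regularN | rewrite mulrN].
Qed.

Lemma ord_ge_le n k x : (k <= n)%N -> ord_ge n x -> ord_ge k x.
Proof.
move=> kn [a ra ->]; exists (tvar ^+ (n - k) * a).
  by apply: regularM => //; apply/regularX/regular_tvar.
by rewrite mulrA -exprD subnKC.
Qed.

Lemma ord_ge_0 n : ord_ge n 0.
Proof. by exists 0; [apply: regular0 | rewrite mulr0]. Qed.

Lemma ord_ge_regular n x : ord_ge n x -> regular x.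
Proof. by move/(ord_ge_le (leq0n n))/ord_ge0. Qed.

Lemma ord_ge_tvar n : ord_ge n (tvar ^+ n).
Proof. by exists 1; [apply: regular1 | rewrite mulr1]. Qed.

End RationalFunctions.

Section Cusp.
Variable K : fieldType.
Local Notation F := {fraction {poly K}}.

(** The ring R = K + t^3 D. *)
Definition cusp_pred : {pred F} :=
  fun x => `[< exists c, ord_ge 3 (x - cst c) >].

Lemma cuspP x : reflect (exists c, ord_ge 3 (x - cst c)) (x \in cusp_pred).
Proof. exact: asboolP. Qed.

Lemma cusp_subring_closed : GRing.subring_closed cusp_pred.
Proof.
split.
- apply/cuspP; exists 1; rewrite cst1 subrr.
  exact: ord_ge_0.
- move=> x y /cuspP[a xa] /cuspP[b yb]; apply/cuspP; exists (a - b).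
  rewrite cstD cstN.
  suff -> : x - y - (cst a - cst b) = (x - cst a) + - (y - cst b).
    by apply: ord_geD => //; apply: ord_geN.
  by ring.
move=> x y /cuspP[a xa] /cuspP[b yb]; apply/cuspP; exists (a * b).
rewrite cstM; suff -> : x * y - cst a * cst b =
    (x - cst a) * (y - cst b) + ((x - cst a) * cst b + cst a * (y - cst b)).
  apply: ord_geD; first exact: ord_ge_le (ord_geM xa yb).
  apply: ord_geD; first by apply: ord_geMr => //; apply: regular_cst.
  by apply: ord_geMl => //; apply: regular_cst.
by ring.
Qed.

HB.instance Definition _ :=
  GRing.isSubringClosed.Build F cusp_pred cusp_subring_closed.

Record cusp := Cusp { cusp_val : F; cusp_valP : cusp_val \in cusp_pred }.

HB.instance Definition _ := [isSub for cusp_val].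
HB.instance Definition _ := [Choice of cusp by <:].
HB.instance Definition _ := [SubChoice_isSubComNzRing of cusp by <:].

Local Notation v := cusp_val.

Lemma cusp_val_inj : injective v. Proof. exact: val_inj. Qed.
Lemma cusp_val1 : v 1 = 1. Proof. by []. Qed.
Lemma cusp_valD x y : v (x + y) = v x + v y. Proof. by []. Qed.
Lemma cusp_valN x : v (- x) = - v x. Proof. by []. Qed.
Lemma cusp_valM x y : v (x * y) = v x * v y. Proof. by []. Qed.
Lemma cusp_valX x n : v (x ^+ n) = v x ^+ n.
Proof. by elim: n => // n IH; rewrite !exprS cusp_valM IH. Qed.
Lemma cusp_val_eq0 x : (v x == 0) = (x == 0).
Proof. by rewrite -(inj_eq cusp_val_inj). Qed.

Lemma ord_ge_cusp x : ord_ge 3 x -> x \in cusp_pred.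
Proof. by move=> x3; apply/cuspP; exists 0; rewrite cst0 subr0. Qed.

Definition cusp_unit : {pred cusp} :=
  fun x => (x != 0) && ((v x)^-1 \in cusp_pred).
Definition cusp_inv (x : cusp) : cusp :=
  if x \in cusp_unit then insubd x (v x)^-1 else x.

Lemma cusp_mulVr : {in cusp_unit, left_inverse 1 cusp_inv *%R}.
Proof.
move=> x xu; apply: cusp_val_inj; rewrite cusp_valM /cusp_inv xu.
have /andP[x0 xV] := xu.
have -> : v (insubd x (v x)^-1) = (v x)^-1 by exact: insubdK.
have vx0 : v x != 0 by rewrite cusp_val_eq0; exact: x0.
by rewrite cusp_val1; exact: mulVf vx0.
Qed.

Lemma cusp_unitP x y : y * x = 1 -> cusp_unit x.
Proof.
move=> /(congr1 v); rewrite cusp_valM cusp_val1 => yx.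
have x0 : v x != 0.
  by apply: contra_eq_neq yx => ->; rewrite mulr0 eq_sym oner_neq0.
rewrite /cusp_unit -cusp_val_eq0 x0 /=.
by rewrite -[_^-1]mul1r -yx mulfK // cusp_valP.
Qed.

Lemma cusp_inv_out : {in [predC cusp_unit], cusp_inv =1 id}.
Proof. by move=> x; rewrite inE /= /cusp_inv => /negPf ->. Qed.

HB.instance Definition _ := GRing.ComNzRing_hasMulInverse.Build cusp
  cusp_mulVr cusp_unitP cusp_inv_out.

Lemma cusp_integral (x y : cusp) : x * y = 0 -> (x == 0) || (y == 0).
Proof.
by move=> /(congr1 v)/eqP; rewrite cusp_valM mulf_eq0 !cusp_val_eq0.
Qed.

HB.instance Definition _ := GRing.ComUnitRing_isIntegral.Build cusp cusp_integral.

Lemma cusp_regular (x : cusp) : regular (v x).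
Proof.
have /cuspP[c ac] := cusp_valP x; rewrite -(subrK (cst c) (v x)).
by apply: regularD (ord_ge_regular ac) (regular_cst _).
Qed.

Definition cusp_of x (x3 : ord_ge 3 x) : cusp := Cusp (ord_ge_cusp x3).

(** The maximal ideal t^3 D. *)
Definition cusp_max : submodClosed cusp^o :=
  lspan (fun x : cusp^o => ord_ge 3 (v x)).

Lemma cusp_maxP (x : cusp) : (x : cusp^o) \in cusp_max <-> ord_ge 3 (v x).
Proof.
apply: (@lspanE _ cusp^o); split=> [|x1 y|a x1 x13].
- exact: ord_ge_0.
- exact: ord_geD.
by apply: ord_geMl x13; apply: cusp_regular.
Qed.

(** The inverse of x = c + t^3 y is c^-1 - c^-1 (x - c) / x. *)
Lemma cusp_unit_out (x : cusp) : (x : cusp^o) \notin cusp_max ->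
  exists y, y * x = 1.
Proof.
move=> xm; have /cuspP[c [y ry xc]] := cusp_valP x.
have c0 : c != 0.
  apply: contraNneq xm => c0; apply/cusp_maxP; exists y => //.
  by rewrite -xc c0 cst0 subr0.
have xE : v x = cst c + tvar K * (tvar K ^+ 2 * y).
  by rewrite mulrA -exprS -xc addrC subrK.
have r2 : regular (tvar K ^+ 2 * y).
  by apply: regularM ry; apply/regularX/regular_tvar.
have [x0 rx] := regular_inv c0 r2; rewrite -xE in x0 rx.
suff xV : (v x)^-1 \in cusp_pred.
  by exists (Cusp xV); apply: cusp_val_inj; rewrite cusp_valM /= mulVf.
apply/cuspP; exists c^-1.
have cc : cst c * cst c^-1 = 1 :> F by rewrite -cstM divff // cst1.
have -> : (v x)^-1 - cst c^-1 = (- cst c^-1 * (v x - cst c)) / v x.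
  rewrite mulrBr mulNr [_ * cst c]mulNr opprK [_ * cst c]mulrC cc.
  by rewrite mulrDl mulNr mulfK // mul1r addrC.
apply: ord_geMr => //; apply: ord_geMl; last by exists y.
exact/regularN/regular_cst.
Qed.

Lemma cusp_local : local_ring cusp_max.
Proof.
have max1 : (1 : cusp^o) \notin cusp_max.
  apply/negP => /cusp_maxP[y ry e].
  have r2 : regular (- (tvar K ^+ 2 * y)).
    by apply/regularN/regularM => //; apply/regularX/regular_tvar.
  have e1 : (1 : K) = 0.
    by apply: (cst_tvar_eq0 r2); rewrite cst1 mulrN mulrA -exprS -e subrr.
  by have := oner_neq0 K; rewrite e1 eqxx.
have maxJ (J : submodClosed cusp^o) :
    (1 : cusp^o) \notin J -> {subset J <= cusp_max}.
  move=> J1 x xJ; apply: contraNT J1 => /cusp_unit_out[y <-].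
  exact: rpredZ.
split; first split=> // J J1 mJ x.
  by apply/idP/idP; [apply: maxJ | apply: mJ].
by move=> J [J1 Jmax] x; apply/esym/Jmax => //; apply: maxJ.
Qed.

Lemma tvar3_ord : ord_ge 3 (tvar K ^+ 3). Proof. exact: ord_ge_tvar. Qed.

Lemma cusp_max_neq0 : exists2 a : cusp, (a : cusp^o) \in cusp_max & a != 0.
Proof.
exists (cusp_of tvar3_ord); first by apply/cusp_maxP; apply: tvar3_ord.
by rewrite -cusp_val_eq0 /= expf_neq0 // tvar_neq0.
Qed.

(** An element of order n divides all those of order at least n + 3, because R
    contains t^3 D. *)
Lemma cusp_dvd (x y : cusp) n u :
  v x = tvar K ^+ n * u -> regular u^-1 -> u != 0 ->
  ord_ge (n + 3) (v y) -> exists z, y = z * x.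
Proof.
move=> xE ru u0 [w rw yE].
have z3 : ord_ge 3 (tvar K ^+ 3 * (w / u)).
  by exists (w / u); first exact: regularM.
have e : v y = tvar K ^+ 3 * (w / u) * v x.
  by rewrite xE yE exprD -[in LHS](divfK u0 w); ring.
by exists (cusp_of z3); apply: cusp_val_inj; rewrite e cusp_valM.
Qed.

(** A prime ideal with a nonzero element x contains m: large powers of the
    elements of m are multiples of x. *)
Lemma cusp_dim1 : ~ prime_chain cusp 2.
Proof.
case=> p pP; have [_ [x [x1 x0]]] := pP 0%N isT.
have [_ [y [y2 y1]]] := pP 1%N isT.
have xN0 : x != 0 by apply: contraNneq x0 => ->; rewrite rpred0.
have vx0 : v x != 0 by rewrite cusp_val_eq0.
have [n [u [ru ruV u0 xE]]] := regular_factor (cusp_regular x) vx0.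
have max_p1 (z : cusp) : (z : cusp^o) \in cusp_max -> z \in p 1%N.
  move=> /cusp_maxP z3.
  have zn : ord_ge (n + 3) (v (z ^+ n.+1)).
    apply: (@ord_ge_le _ (3 * n.+1)).
      by rewrite mulnS addnC leq_add2l leq_pmull.
    rewrite cusp_valX; elim: n.+1 => [|k IH].
      by apply/ord_ge0; apply: regular1.
    by rewrite exprS mulnS; apply: ord_geM.
  have [w zw] := cusp_dvd xE ruV u0 zn.
  have : z ^+ n.+1 \in p 1%N by rewrite zw; apply: idealMr.
  elim: n.+1 => [|k IH]; first by rewrite expr0 idealr1.
  by rewrite exprS prime_idealrM => /orP[].
have /cusp_unit_out[w wy] : (y : cusp^o) \notin cusp_max.
  by apply: contra y1; apply: max_p1.
by have := idealr1 (p 2); rewrite -wy idealMr.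
Qed.

(** The elements of t-adic valuation n. *)
Definition exact_ord n (x : cusp) : Prop :=
  exists u, [/\ regular u, regular u^-1, u != 0 & v x = tvar K ^+ n * u].

Lemma exact_ord_ge n x : exact_ord n x -> ord_ge n (v x).
Proof. by move=> [u [ru _ _ xE]]; exists u. Qed.

Lemma exact_ord_exists x : x != 0 -> exists n, exact_ord n x.
Proof.
rewrite -cusp_val_eq0 => vx0.
by have [n [u ?]] := regular_factor (cusp_regular x) vx0; exists n, u.
Qed.

Lemma cst_cusp c : cst c \in cusp_pred.
Proof. by apply/cuspP; exists c; rewrite subrr; apply: ord_ge_0. Qed.

Lemma ord_geS n y : ord_ge n (v y) -> ord_ge n.+1 (v y) \/ exact_ord n y.
Proof.
move=> [w rw yE]; have [c [z [rz wE]]] := regular_split rw.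
have [c0|c0] := eqVneq c 0.
  by left; exists z => //; rewrite yE wE c0 cst0 add0r mulrA -exprSr.
right; exists w; have [w0 wV] := regular_inv c0 rz; rewrite -wE in w0 wV.
by split.
Qed.

Lemma ord_ge_reduce n x y : exact_ord n x -> ord_ge n (v y) ->
  exists c, ord_ge n.+1 (v (y - c * x)).
Proof.
move=> [u [ru ruV u0 xE]] [w rw yE].
have [c [z [rz wE]]] := regular_split (regularM rw ruV).
exists (Cusp (cst_cusp c)); rewrite cusp_valD cusp_valN cusp_valM xE yE.
change (v (Cusp (cst_cusp c))) with (cst c).
exists (z * u); first exact: regularM.
by rewrite -[w](divfK u0) wE exprSr; ring.
Qed.

(** If n is the least order of a nonzero element of the ideal I, then I is
    generated by elements of orders n, n + 1 and n + 2, taken to be 0 when there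
    are none: subtracting multiples of these brings any element of I to order at
    least n + 3, where it is a multiple of the first one. *)
Lemma cusp_noetherian : noetherian cusp.
Proof.
move=> I.
have [I0|] := EM (forall x : cusp, (x : cusp^o) \in I -> x = 0).
  exists [::] => x; apply/idP/idP => [/I0 ->|]; first exact: rpred0.
  by move/(@seq_span_nil _ cusp^o) ->; apply: rpred0.
move=> /existsNP[x1 /not_implyP[x1I /eqP/exact_ord_exists[n1 x1n]]].
have exn :
    exists n, `[< exists x : cusp, (x : cusp^o) \in I /\ exact_ord n x >].
  by exists n1; apply/asboolP; exists x1.
case: (ex_minnP exn) => n /asboolP[x0 [x0I x0n]] min_n.
have geI (y : cusp) : (y : cusp^o) \in I -> ord_ge n (v y).
  move=> yI; have [->|/exact_ord_exists[k yk]] := eqVneq y 0.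
    exact: ord_ge_0.
  apply: ord_ge_le (exact_ord_ge yk); apply: min_n.
  by apply/asboolP; exists y.
have /boolp.choice[g gE] k : exists g : cusp, (g : cusp^o) \in I /\
    ((exists x : cusp, (x : cusp^o) \in I /\ exact_ord k x) -> exact_ord k g).
  have [[x [xI xk]]|no] :=
    EM (exists x : cusp, (x : cusp^o) \in I /\ exact_ord k x).
    by exists x.
  by exists 0; split; first exact: rpred0.
have gI k : (g k : cusp^o) \in I by case: (gE k).
have step k (y : cusp) : (y : cusp^o) \in I -> ord_ge k (v y) ->
    exists c : cusp, ((y - c * g k : cusp) : cusp^o) \in I /\
      ord_ge k.+1 (v (y - c * g k)).
  move=> yI yk.
  have cI (c : cusp) : ((y - c * g k : cusp) : cusp^o) \in I.
    apply: (@submod_rpredB cusp cusp^o I y (c *: (g k : cusp^o)) yI).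
    exact: rpredZ.
  have [yS|ye] := ord_geS yk; last first.
    have gk : exact_ord k (g k) by apply: (gE k).2; exists y.
    by have [c cE] := ord_ge_reduce gk yk; exists c.
  by exists 0; split => //; rewrite mul0r subr0.
have gn : exact_ord n (g n) by apply: (gE n).2; exists x0.
exists [:: g n; g n.+1; g n.+2] => y; apply/idP/idP => [yI|]; last first.
  by apply: lspan_min => z /=; rewrite !inE => /or3P[] /eqP ->; apply: gI.
have [c0 [y0I y0]] := step n y yI (geI y yI).
have [c1 [y1I y1]] := step n.+1 _ y0I y0.
have [c2 [_ y2]] := step n.+2 _ y1I y1.
have [u [_ ruV u0 gnE]] := gn.
have [|z zE] := cusp_dvd gnE ruV u0
  (y := y - c0 * g n - c1 * g n.+1 - c2 * g n.+2).
  by rewrite addn3.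
have -> : y = (z + c0) * g n + c1 * g n.+1 + c2 * g n.+2.
  by rewrite mulrDl -zE; ring.
have mem k : k \in [:: n; n.+1; n.+2] ->
    (g k : cusp^o) \in ideal_gen [:: g n; g n.+1; g n.+2].
  move=> kn; apply: lspan_sub; exact: (map_f g kn).
apply: rpredD; first apply: rpredD; apply: (@rpredZ _ cusp^o); apply: mem;
  by rewrite !inE eqxx ?orbT.
Qed.

End Cusp.

(** * The ideal (t^3, t^4) and the failure of the algebra axiom *)

Section Counterexample.
Variable K : fieldType.
Local Notation R := (cusp K).
Local Notation v := (@cusp_val K).
Local Notation t := (tvar K).

Lemma tvar4_ord : ord_ge 3 (t ^+ 4).
Proof. by apply: ord_ge_le (ord_ge_tvar K 4). Qed.

Definition t3 : R := cusp_of (tvar3_ord K).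
Definition t4 : R := cusp_of tvar4_ord.

(** The ideal (t^3, t^4), and the same as a module.  The name refers to the
    missing term in t^5 of its elements. *)
Definition gap_ideal : submodClosed R^o := ideal_gen [:: t3; t4].
Definition gap : lmodType R := submodule_type gap_ideal.

Lemma t3_gap : (t3 : R^o) \in gap_ideal.
Proof. by apply: lspan_sub; rewrite /= inE eqxx. Qed.
Lemma t4_gap : (t4 : R^o) \in gap_ideal.
Proof. by apply: lspan_sub; rewrite /= !inE eqxx orbT. Qed.

Definition gx : gap := Submod t3_gap.
Definition gy : gap := Submod t4_gap.

(** The rational function underlying an element of the ideal. *)
Definition gval (z : gap) : {fraction {poly K}} := v (submod_val z).

Lemma gval_inj : injective gval.
Proof. by move=> x y /cusp_val_inj e; apply: val_inj. Qed.
Lemma gvalD x y : gval (x + y) = gval x + gval y.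
Proof. by rewrite /gval submod_valD; apply: cusp_valD. Qed.
Lemma gvalZ a x : gval (a *: x) = v a * gval x.
Proof. by rewrite /gval submod_valZ; apply: cusp_valM. Qed.
Lemma gval0 : gval 0 = 0.
Proof. by apply: (addIr (gval 0)); rewrite -gvalD !add0r. Qed.
Lemma gval_gx : gval gx = t ^+ 3. Proof. by []. Qed.
Lemma gval_gy : gval gy = t ^+ 4. Proof. by []. Qed.

Lemma gap_gen (z : gap) : exists a b, z = a *: gx + b *: gy.
Proof.
have [a /seq_span_cons[b /seq_span_nil e]] :=
  @seq_span_cons R R^o _ _ _ (submod_valP z).
exists a, b; apply: val_inj => /=.
by apply/eqP; rewrite -subr_eq0 opprD addrA; apply/eqP.
Qed.

Lemma gval_expansion z :
  exists a b, ord_ge 6 (gval z - cst a * t ^+ 3 - cst b * t ^+ 4).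
Proof.
have [r [s ->]] := gap_gen z; rewrite gvalD !gvalZ gval_gx gval_gy.
have /cuspP[a ra] := cusp_valP r; have /cuspP[b sb] := cusp_valP s.
exists a, b.
have -> : v r * t ^+ 3 + v s * t ^+ 4 - cst a * t ^+ 3 - cst b * t ^+ 4 =
    (v r - cst a) * t ^+ 3 + (v s - cst b) * t ^+ 4 by ring.
apply: ord_geD; first exact: (ord_geM ra (ord_ge_tvar K 3)).
exact: (ord_geM sb tvar4_ord).
Qed.

Lemma gval_ord z : ord_ge 3 (gval z).
Proof.
have [a [b ab]] := gval_expansion z.
have -> : gval z = gval z - cst a * t ^+ 3 - cst b * t ^+ 4 +
   (cst a * t ^+ 3 + cst b * t ^+ 4) by ring.
apply: ord_geD; first exact: ord_ge_le ab.
apply: ord_geD; apply: ord_geMl; try exact: regular_cst.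
  exact: ord_ge_tvar.
exact: tvar4_ord.
Qed.

Lemma ord_ge_tvar3 : ~ ord_ge 6 (t ^+ 3).
Proof.
move=> [y ry e]; have := oner_neq0 K; suff -> : (1 : K) = 0 by rewrite eqxx.
have r2 : regular (- (t ^+ 2 * y)).
  by apply/regularN/regularM => //; apply/regularX/regular_tvar.
apply: (cst_tvar_eq0 r2); apply: (mulfI (expf_neq0 3 (tvar_neq0 K))).
rewrite mulr0 cst1 mulrDr mulr1 {1}e; ring.
Qed.

(** Let c = t^3 (a + bt + ...) be in the ideal.  The term in t^5 of tc is b t^5,
    and that of t^2 c is a t^5; if both are in the ideal, then a = b = 0. *)
Lemma gap_colon c0 c1 c2 :
  gval c1 = t * gval c0 -> gval c2 = t ^+ 2 * gval c0 -> ord_ge 6 (gval c0).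
Proof.
have [a0 [b0 [y0 ry0 e0]]] := gval_expansion c0.
have [a1 [b1 [y1 ry1 e1]]] := gval_expansion c1.
have [a2 [b2 [y2 ry2 e2]]] := gval_expansion c2.
move/(canRL (subrK _))/(canRL (subrK _)) in e0.
move/(canRL (subrK _))/(canRL (subrK _)) in e1.
move/(canRL (subrK _))/(canRL (subrK _)) in e2.
move=> h1 h2; rewrite e1 e0 in h1; rewrite e2 e0 in h2.
move/eqP: h1; rewrite -subr_eq0 => /eqP h1.
move/eqP: h2; rewrite -subr_eq0 => /eqP h2.
have t3N0 := expf_neq0 3 (tvar_neq0 K).
have rt := regular_tvar K.
have [_ _ bz] : [/\ a1 = 0, b1 - a0 = 0 & - b0 = 0].
  apply: (@tvar_expansion_eq0 K _ _ _ (y1 - t * y0)).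
    by apply: regularD ry1 (regularN _); apply: regularM.
  apply: (mulfI t3N0); rewrite mulr0 cstD !cstN.
  by rewrite -[RHS]h1; ring.
have [_ _ az] : [/\ a2 = 0, b2 = 0 & - a0 = 0].
  apply: (@tvar_expansion_eq0 K _ _ _ (y2 - cst b0 - t ^+ 2 * y0)).
    apply: regularD (regularD ry2 (regularN (regular_cst _))) (regularN _).
    by apply: regularM => //; apply: regularX.
  apply: (mulfI t3N0); rewrite mulr0 !cstN.
  by rewrite -[RHS]h2; ring.
have a00 : a0 = 0 by apply: oppr_inj; rewrite oppr0.
have b00 : b0 = 0 by apply: oppr_inj; rewrite oppr0.
by exists y0 => //; rewrite e0 a00 b00 cst0 !mul0r !addr0.
Qed.

Section Bilinear.
Variable b : {linear gap -> {linear gap -> gap}}.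

Lemma bilin_scale r s x y :
  gval (b (r *: x) (s *: y)) = v r * v s * gval (b x y).
Proof. by rewrite [b (r *: x)]linearZ_LR hom_scaleE linearZ_LR !gvalZ mulrA. Qed.

(** As t^3 gy = t^4 gx in the ideal, a bilinear map multiplies by t when gx is
    replaced by gy. *)
Lemma bilin_gyl y : gval (b gy y) = t * gval (b gx y).
Proof.
have e : t3 *: gy = t4 *: gx.
  by apply: gval_inj; rewrite !gvalZ gval_gx gval_gy mulrC.
apply: (mulfI (expf_neq0 3 (tvar_neq0 K))).
have := congr1 (fun z => gval (b z y)) e => /=.
rewrite !linearZ_LR !hom_scaleE !gvalZ.
by rewrite mulrA -exprSr.
Qed.

Lemma bilin_gyr x : gval (b x gy) = t * gval (b x gx).
Proof.
have e : t3 *: gy = t4 *: gx.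
  by apply: gval_inj; rewrite !gvalZ gval_gx gval_gy mulrC.
apply: (mulfI (expf_neq0 3 (tvar_neq0 K))).
have := congr1 (fun z => gval (b x z)) e => /=; rewrite !linearZ_LR !gvalZ.
by rewrite mulrA -exprSr.
Qed.

Lemma bilin_ord x y : ord_ge 6 (gval (b x y)).
Proof.
have bxx : ord_ge 6 (gval (b gx gx)).
  apply: (@gap_colon _ (b gx gy) (b gy gy)); first exact: bilin_gyr.
  by rewrite bilin_gyl bilin_gyr mulrA.
have [p [q ->]] := gap_gen x; have [r [s ->]] := gap_gen y.
have rt := regular_tvar K.
have bxy : ord_ge 6 (gval (b gx gy)) by rewrite bilin_gyr; apply: ord_geMl.
have byx : ord_ge 6 (gval (b gy gx)) by rewrite bilin_gyl; apply: ord_geMl.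
have byy : ord_ge 6 (gval (b gy gy)) by rewrite bilin_gyl; apply: ord_geMl.
have bDl u u' w : b (u + u') w = b u w + b u' w by rewrite [b (u + u')]linearD.
rewrite bDl !(linearD (b _)) !gvalD.
by do !apply: ord_geD; rewrite bilin_scale; apply: ord_geMl => //;
  apply: regularM; apply: cusp_regular.
Qed.

End Bilinear.

Lemma gap_torsion_free (a : R) (x : gap) : a *: x = 0 -> a = 0 \/ x = 0.
Proof.
move/(congr1 gval)/eqP; rewrite gvalZ gval0 mulf_eq0 cusp_val_eq0.
case/orP => /eqP x0.
  by left.
by right; apply: gval_inj; rewrite gval0.
Qed.

(** The product of the ideal with m is in t^6 D. *)
Lemma gx_notin :
  gx \notin lspan [set y : gap | exists a z,
    (a : R^o) \in cusp_max K /\ y = (a : R) *: z]%classic.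
Proof.
apply/negP => gx_in; apply: ord_ge_tvar3; rewrite -gval_gx.
apply: (lspan_ind (T := fun z : gap => ord_ge 6 (gval z)) _ _ gx_in).
  split=> [|x y x6 y6|a x x6]; first by rewrite gval0; apply: ord_ge_0.
    by rewrite gvalD; apply: ord_geD.
  by rewrite gvalZ; apply: ord_geMl => //; apply: cusp_regular.
move=> _ [a [z [/cusp_maxP am ->]]]; rewrite gvalZ.
exact: (ord_geM am (gval_ord z)).
Qed.

(** The pair e of generators: every element of the ideal is the image of e under
    a linear map from the square of the ideal. *)
Definition gap_pair : (gap * gap)%type := (gx, gy).

Lemma fin_gen_gap_pair : fin_gen (gap * gap)%type.
Proof.
suff fg : fin_gen gap by apply: fin_gen_prod.
exact: fin_gen_two gap_gen.
Qed.

Lemma gap_pair_phantom :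
  Defs.phantom (module_closure gap) (from_ring gap_pair).
Proof.
apply: phantom_of_extension => [r s|z].
  move=> /(congr1 (fun z : gap * gap => gval z.1)).
  rewrite /= !gvalZ gval_gx => /(mulIf (expf_neq0 3 (tvar_neq0 K))).
  exact: cusp_val_inj.
have [a [b ->]] := gap_gen z.
have gl : linear (fun p : gap * gap => a *: p.1 + b *: p.2).
  move=> c p q /=; rewrite !scalerDr !scalerA addrACA.
  by rewrite ![_ * c]mulrC -!scalerA.
exists (linear_map_of gl).
by have -> : from_ring gap_pair 1 = gap_pair by exact: scale1r.
Qed.

Lemma gap_not_algebra : ~ algebra_axiom (module_closure gap).
Proof.
move=> /(_ _ _ fin_gen_gap_pair gap_pair_phantom).
move=> /(extension_of_phantom (@cusp_noetherian K)
  (fin_gen_sym2 fin_gen_gap_pair)) /(_ gx)[G].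
have -> : from_ring (sym2_mul gap_pair gap_pair) 1 = sym2_mul gap_pair gap_pair.
  exact: scale1r.
move=> GE.
have bil (i j : {linear gap -> (gap * gap)%type}) x y :
    ord_ge 6 (gval (G (sym2_mul (i x) (j y)))).
  have fl u : linear (fun w => G (sym2_mul (i u) (j w))).
    by move=> c w w'; rewrite linearP sym2_mul_linear_r linearP.
  have fr w : linear (fun u => G (sym2_mul (i u) (j w))).
    by move=> c u u'; rewrite linearP sym2_mul_linear_l linearP.
  exact: (bilin_ord (bilinear_of fl fr) x y).
have il : linear (fun x : gap => (x, 0) : (gap * gap)%type).
  by move=> c x y; congr pair; rewrite /= scaler0 addr0.
have jl : linear (fun x : gap => (0, x) : (gap * gap)%type).
  by move=> c x y; congr pair; rewrite /= scaler0 addr0.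
apply: ord_ge_tvar3; rewrite -gval_gx -GE.
have -> : gap_pair = linear_map_of il gx + linear_map_of jl gy.
  by congr pair; rewrite /= ?addr0 ?add0r.
set e1 := linear_map_of il gx; set e2 := linear_map_of jl gy.
have -> : sym2_mul (e1 + e2) (e1 + e2) =
    sym2_mul e1 e1 + sym2_mul e1 e2 + (sym2_mul e2 e1 + sym2_mul e2 e2).
  rewrite -!(linearD (linear_map_of (sym2_mul_linear_r _))).
  by rewrite -(linearD (linear_map_of (sym2_mul_linear_l _))).
by rewrite !linearD !gvalD; do !apply: ord_geD; apply: bil.
Qed.

End Counterexample.

Theorem theorem4p6 :
  exists (R : idomainType) (m : submodClosed R^o) (cl : closure_map R),
    [/\ noetherian R, local_ring m, dietz_closure m cl & ~ algebra_axiom cl].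
Proof.
exists (cusp rat), (cusp_max rat), (module_closure (gap rat)); split.
- exact: cusp_noetherian.
- exact: cusp_local.
- apply: module_closure_dietz (@cusp_unit_out rat) (cusp_max_neq0 rat)
    (@cusp_dim1 rat) (@gx_notin rat) (@gap_torsion_free rat).
exact: gap_not_algebra.
Qed.
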